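(* Let $X$ be a nonnegative absolutely continuous random variable with cumulative distribution function $F$ and support $(0,l)$, let $\alpha>0$, and suppose that either $0<l<+\infty$, or $l=+\infty$ and $\lim_{x\to+\infty}x\,[-\ln F(x)]^{\alpha}=0$. For $\theta>0$ let $X_\theta$ satisfy the proportional reversed hazard model, i.e. $X_\theta$ has cumulative distribution function $F_{X_\theta}(x)=[F(x)]^{\theta}$, $x\in\mathbb R$. Then $$CE_{\alpha}(X_{\theta})=\mathcal{E}_{\theta}(\alpha)-\mathcal{E}_{\theta}(\alpha+1),$$ where, for $\beta>0$, $$\mathcal{E}_{\theta}(\beta):=\frac{1}{\Gamma(\beta)}\,\mathbb{E}\left[X_{\theta}\left[-\ln F_{X_{\theta}}(X_{\theta})\right]^{\beta-1}\right].$$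
   Context: For a nonnegative random variable $W$ with support $(0,l)$ and cumulative distribution function $F_W$, the fractional generalized cumulative entropy of order $\alpha>0$ is $CE_{\alpha}(W)=\frac{1}{\Gamma(\alpha+1)}\int_{0}^{l}F_W(x)[-\ln F_W(x)]^{\alpha}\,dx$, defined provided this integral is finite; it is a standing assumption that the entropies appearing are finite. *)

(* Defs.v *)
From HB Require Import structures.
From mathcomp Require Import all_boot all_order all_algebra.
From mathcomp Require Import all_classical all_reals all_analysis.

Set Implicit Arguments.
Unset Strict Implicit.
Unset Printing Implicit Defensive.

Import Order.TTheory GRing.Theory Num.Theory.
Import numFieldNormedType.Exports.

Local Open Scope classical_set_scope.
Local Open Scope ring_scope.

(* Euler's integral; the intended value for 0 < a. *)
Definition Gamma (R : realType) (a : R) : R :=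
  \int[lebesgue_measure]_(t in `]0, +oo[) (t `^ (a - 1) * expR (- t)).

Definition cdfR d (T : measurableType d) (R : realType) (P : probability T R)
  (W : {RV P >-> R}) (x : R) : R := fine (cdf W x).

Definition absolutely_continuous d (T : measurableType d) (R : realType)
  (P : probability T R) (W : {RV P >-> R}) : Prop :=
  distribution P W `<< (@lebesgue_measure R).

(* The interval (0, l), where l may be +oo. *)
Definition oint0 (R : realType) (l : \bar R) : set R :=
  [set x : R | 0 < x /\ (x%:E < l)%E].

(* The (closed, topological) support of the law of W. *)
Definition law_support d (T : measurableType d) (R : realType)
  (P : probability T R) (W : {RV P >-> R}) : set R :=
  [set x : R | forall U : set R, open U -> U x -> (0 < distribution P W U)%E].

(* "W has support (0, l)": the support of a law is a closed set, so it is the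
   closure of the interval that is prescribed.  This holds in particular when
   W has a density that is positive on (0, l) and zero elsewhere. *)
Definition has_support d (T : measurableType d) (R : realType)
  (P : probability T R) (W : {RV P >-> R}) (l : \bar R) : Prop :=
  law_support W = closure (oint0 l).

(* CE_alpha(W) for W with support (0, l).  The value is an extended real, so
   that the finiteness of the entropy can be stated. *)
Definition CE d (T : measurableType d) (R : realType) (P : probability T R)
  (l : \bar R) (alpha : R) (W : {RV P >-> R}) : \bar R :=
  (((Gamma (alpha + 1))^-1)%:E *
   \int[lebesgue_measure]_(x in oint0 l)
     (cdfR W x * (- ln (cdfR W x)) `^ alpha)%:E)%E.

Definition calE d (T : measurableType d) (R : realType) (P : probability T R)
  (W : {RV P >-> R}) (beta : R) : \bar R :=
  (((Gamma beta)^-1)%:E *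
   'E_P[(fun w => W w * (- ln (cdfR W (W w))) `^ (beta - 1))%R])%E.

(* Proportional reversed hazard model: W has cdf F_X ^ theta.  W may live on a
   different probability space. *)
Definition PRH d (T : measurableType d) d' (T' : measurableType d')
  (R : realType) (P : probability T R) (Q : probability T' R)
  (X : {RV P >-> R}) (theta : R) (W : {RV Q >-> R}) : Prop :=
  forall x : R, cdfR W x = cdfR X x `^ theta.

(* Main.v *)
(** Write [W] for [Xtheta], [G] for its cdf and [U := - ln (G W)].  Absolute
continuity of [X] makes [G] take every value in (0, 1), hence [U] has the
standard exponential law, and up to null sets [W > x] is the event
[U <= - ln (G x)].  Since [t^a e^-t] is a primitive of
[(a t^(a-1) - t^a) e^-t], this gives, for every [x],

  [a E[U^(a-1); W > x] = E[U^a; W > x] + G x (- ln (G x))^a],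

and integrating over [x > 0] (Tonelli) yields
[a E[W U^(a-1)] = E[W U^a] + \int G (- ln G)^a].  All terms are nonnegative, so
subtracting only requires finiteness of [E[W U^(a-1)]].  This follows from
finiteness of the entropy: for [x] so large that [G x >= e^(-a/2)], one has
[U <= a/2] on [W > x], hence [(a/2) E[U^(a-1); W > x] <= G x (- ln (G x))^a]. *)
Require Import Defs.
From HB Require Import structures.
From mathcomp Require Import all_boot all_order all_algebra.
From mathcomp Require Import all_classical all_reals all_analysis.
From mathcomp Require Import measurable_realfun ring lra.

Set Implicit Arguments.
Unset Strict Implicit.
Unset Printing Implicit Defensive.

Import Order.TTheory GRing.Theory Num.Theory.
Import numFieldNormedType.Exports.

Local Open Scope classical_set_scope.
Local Open Scope ring_scope.

(** * A two-sided fundamental theorem of calculus *)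

Section FTC.
Context {R : realType}.
Notation mu := (@lebesgue_measure R).
Variables (f g F : R -> R) (a : R).
Hypothesis f0 : forall x, a < x -> 0 <= f x.
Hypothesis g0 : forall x, a < x -> 0 <= g x.
Hypothesis cf : {in `]a, +oo[%R, continuous f}.
Hypothesis cg : {in `]a, +oo[%R, continuous g}.
Hypothesis dF : forall x, a < x -> is_derive x 1 F (f x - g x).
Hypothesis Fa : F x @[x --> a^'+] --> F a.

Let within_cc (h : R -> R) c b : {in `]a, +oo[%R, continuous h} -> a < c ->
  {within `[c, b], continuous h}.
Proof.
move=> ch ac; apply: continuous_in_subspaceT => x; rewrite inE/= in_itv/=.
by move=> /andP[cx _]; apply: ch; rewrite in_itv/= andbT (lt_le_trans ac).
Qed.

(** Away from [a] both integrands are continuous on a compact interval, hence integrable, so the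
    integral of [f - g] may be split and its parts moved across the equality. *)
Let FTC_cc c b : a < c -> c < b ->
  (\int[mu]_(x in `[c, b]) (f x)%:E + (F c)%:E =
   \int[mu]_(x in `[c, b]) (g x)%:E + (F b)%:E)%E.
Proof.
move=> ac cb.
have If : mu.-integrable `[c, b] (EFin \o f).
  apply: continuous_compact_integrable; first exact: segment_compact.
  exact: within_cc.
have Ig : mu.-integrable `[c, b] (EFin \o g).
  apply: continuous_compact_integrable; first exact: segment_compact.
  exact: within_cc.
have cF x : a < x -> {for x, continuous F}.
  move=> ax; apply: differentiable_continuous; apply/derivable1_diffP.
  by have [] := dF ax.
have : (\int[mu]_(x in `[c, b]) (f x - g x)%:E = (F b)%:E - (F c)%:E)%E.
  apply: (@continuous_FTC2 _ (fun x => f x - g x)) => //.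
  - by apply: within_cc => // x xa; apply: cvgB; [exact: cf|exact: cg].
  - split.
    + move=> x; rewrite in_itv/= => /andP[cx _].
      by have [] := dF (lt_trans ac cx).
    + by apply: cvg_at_right_filter; exact: cF.
    + by apply: cvg_at_left_filter; apply: cF; exact: lt_trans cb.
  - move=> x; rewrite in_itv/= => /andP[cx _]; rewrite derive1E.
    by have [_ ->] := dF (lt_trans ac cx).
under eq_integral do rewrite EFinB.
rewrite integralB//=.
have /fineK <- : (\int[mu]_(x in `[c, b]) (f x)%:E)%E \is a fin_num.
  exact: integrable_fin_num.
have /fineK <- : (\int[mu]_(x in `[c, b]) (g x)%:E)%E \is a fin_num.
  exact: integrable_fin_num.
rewrite -!EFinB -!EFinD => -[] h; congr EFin.
lra.
Qed.

Let mh (h : R -> R) (A : set R) : {in `]a, +oo[%R, continuous h} ->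
  measurable A -> A `<=` `]a, +oo[ -> measurable_fun A h.
Proof.
move=> ch mA Aa; apply: (@measurable_funS _ _ _ _ `]a, +oo[%classic) => //.
apply: open_continuous_measurable_fun => //.
by move=> x; rewrite inE/= => ax; exact: ch.
Qed.

(** Each of [f] and [g] stays on its own side, so the identity makes sense in the extended reals
    even when the integrals diverge at [a]. It is the monotone limit of the compact case over
    [[a + 1/(n+1), b]]; right continuity of [F] at [a] handles the boundary term. *)
Lemma ge0_FTC2_oc b : a <= b ->
  (\int[mu]_(x in `]a, b]) (f x)%:E + (F a)%:E =
   \int[mu]_(x in `]a, b]) (g x)%:E + (F b)%:E)%E.
Proof.
rewrite le_eqVlt => /predU1P[<-|ab]; first by rewrite set_itvoc0 !integral_set0.
pose e n : R := n.+1%:R^-1.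
have e0 n : 0 < e n by rewrite invr_gt0 ltr0n.
pose A n : set R := `[a + e n, b]%classic.
have Aa n : A n `<=` `]a, +oo[.
  move=> x; rewrite /A/= !in_itv/= andbT => /andP[+ _].
  by apply: lt_le_trans; rewrite ltrDl.
have ndA : nondecreasing_seq A.
  move=> n m nm; apply/subsetPset => x; rewrite /A/= !in_itv/= => /andP[ax ->].
  rewrite andbT (le_trans _ ax)// lerD2l lef_pV2 ?posrE ?ltr0n//.
  by rewrite ler_nat.
have cvgA (h : R -> R) : {in `]a, +oo[%R, continuous h} ->
    (forall x, a < x -> 0 <= h x) ->
    (\int[mu]_(x in A n) (h x)%:E)%E @[n --> \oo] -->
    (\int[mu]_(x in `]a, b]) (h x)%:E)%E.
  move=> ch h0; rewrite itv_open_bnd_bigcup -/(\bigcup_n A n).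
  have := @ge0_nondecreasing_set_cvg_integral _ (measurableTypeR R) _ A
    (EFin \o h) mu ndA; apply.
  - by move=> i; exact: measurable_itv.
  - by move=> i; apply/measurable_EFinP; apply: mh => //; exact: measurable_itv.
  - by move=> i x /Aa/=; rewrite in_itv/= andbT lee_fin => /h0.
have cvgF : (F (a + e n))%:E @[n --> \oo] --> (F a)%:E.
  apply: cvg_EFin; first exact: nearW.
  move/cvg_at_rightP : Fa; apply; split => [n|]; first by rewrite ltrDl.
  rewrite -[X in _ --> X]addr0; apply: (@cvgD _ R^o); first exact: cvg_cst.
  exact: cvg_harmonic.
have /(_ _) L := cvgeD (fin_num_adde_defl _ (erefl : (F a)%:E \is a fin_num))
  (cvgA f cf f0) cvgF.
have /(_ _ _) Rr := cvgeD (fin_num_adde_defl _ (erefl : (F b)%:E \is a fin_num))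
  (cvgA g cg g0) (cvg_cst (F b)%:E).
(* Both sides of the claim are limits of sequences that agree as soon as [a + e n < b]. *)
suff /cvg_trans/(_ Rr) L' : (\int[mu]_(x in A n) (f x)%:E + (F (a + e n))%:E)%E
    @[n --> \oo] `=>` (\int[mu]_(x in A n) (g x)%:E + (F b)%:E)%E @[n --> \oo].
  exact: (cvg_unique _ L L').
apply: near_eq_cvg; near=> n => /=.
rewrite FTC_cc ?ltrDl//; near: n.
have : a + e n @[n --> \oo] --> a + 0.
  by apply: cvgD; [exact: cvg_cst|exact: cvg_harmonic].
by rewrite addr0 => /cvgr_lt; apply.
Unshelve. all: by end_near. Qed.

(** Again by monotone convergence, now along the intervals []a, a + n]]. *)
Lemma ge0_FTC2_oy l : F x @[x --> +oo] --> l ->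
  (\int[mu]_(x in `]a, +oo[) (f x)%:E + (F a)%:E =
   \int[mu]_(x in `]a, +oo[) (g x)%:E + l%:E)%E.
Proof.
move=> Fl.
pose A n : set R := `]a, a + n%:R]%classic.
have Aa n : A n `<=` `]a, +oo[.
  by move=> x; rewrite /A/= !in_itv/= andbT => /andP[].
have ndA : nondecreasing_seq A.
  move=> n m nm; apply/subsetPset => x; rewrite /A/= !in_itv/=.
  move=> /andP[-> /= ax].
  by rewrite (le_trans ax)// lerD2l ler_nat.
have cvgA (h : R -> R) : {in `]a, +oo[%R, continuous h} ->
    (forall x, a < x -> 0 <= h x) ->
    (\int[mu]_(x in A n) (h x)%:E)%E @[n --> \oo] -->
    (\int[mu]_(x in `]a, +oo[) (h x)%:E)%E.
  move=> ch h0; rewrite itv_bndy_bigcup_BRight -/(\bigcup_n A n).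
  have := @ge0_nondecreasing_set_cvg_integral _ (measurableTypeR R) _ A
    (EFin \o h) mu ndA; apply.
  - by move=> i; exact: measurable_itv.
  - by move=> i; apply/measurable_EFinP; apply: mh => //; exact: measurable_itv.
  - by move=> i x /Aa/=; rewrite in_itv/= andbT lee_fin => /h0.
have cvgF : (F (a + n%:R))%:E @[n --> \oo] --> l%:E.
  apply: cvg_EFin; first exact: nearW.
  apply/((cvg_pinftyP F l).1 Fl)/cvgryPge => r.
  by near do rewrite -lerBlDl; exact: nbhs_infty_ger.
have /(_ _ _) L := cvgeD (fin_num_adde_defl _ (erefl : (F a)%:E \is a fin_num))
  (cvgA f cf f0) (cvg_cst (F a)%:E).
have /(_ _) Rr := cvgeD (fin_num_adde_defl _ (erefl : l%:E \is a fin_num))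
  (cvgA g cg g0) cvgF.
suff /cvg_trans/(_ Rr) L' : (\int[mu]_(x in A n) (f x)%:E + (F a)%:E)%E
    @[n --> \oo] `=>` (\int[mu]_(x in A n) (g x)%:E + (F (a + n%:R))%:E)%E
    @[n --> \oo].
  exact: (cvg_unique _ L L').
apply: near_eq_cvg; apply: nearW => n /=.
by rewrite ge0_FTC2_oc// lerDl.
Unshelve. all: by end_near. Qed.

End FTC.

(** * The Gamma integral *)

Section gamma_integral.
Context {R : realType}.
Notation mu := (@lebesgue_measure R).
Implicit Types a s t : R.

(** The integrand of Gamma at [a + 1]. At [t = - ln v] with [0 < v] it equals [v (- ln v)^a], which
    is how the entropy integrand enters. *)
Definition powR_expRN a t : R := t `^ a * expR (- t).

Lemma powR_expRN_ge0 a t : 0 <= powR_expRN a t.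
Proof. by rewrite mulr_ge0 ?powR_ge0 ?expR_ge0. Qed.

Lemma powR_expRN_gt0 a t : 0 < t -> 0 < powR_expRN a t.
Proof. by move=> t0; rewrite mulr_gt0 ?powR_gt0 ?expR_gt0. Qed.

Lemma measurable_powR_expRN a : measurable_fun [set: R] (powR_expRN a).
Proof.
apply: measurable_funM; first exact: measurable_powR.
by apply: measurableT_comp => //; exact: measurable_expR.
Qed.

Lemma is_derive_powR_expRN a t : 0 < t ->
  is_derive t 1 (powR_expRN a) (a * powR_expRN (a - 1) t - powR_expRN a t).
Proof.
move=> t0.
have dp := is_derive1_powR a t0.
have de : is_derive t 1 (fun x : R => expR (- x)) (- expR (- t)).
  by apply: is_derive_eq; rewrite /= mulrN1.
apply: (@is_derive_eq _ _ _ _ _ _ _ _ (is_deriveM dp de)).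
rewrite /powR_expRN /GRing.scale/=; ring.
Qed.

Lemma continuous_powR_expRN a : {in `]0, +oo[%R, continuous (powR_expRN a)}.
Proof.
move=> t; rewrite in_itv/= andbT => t0.
apply: differentiable_continuous; apply/derivable1_diffP.
by have [] := is_derive_powR_expRN a t0.
Qed.

Lemma powR_expRN0 a : a != 0 -> powR_expRN a 0 = 0.
Proof. by move=> a0; rewrite /powR_expRN powR0// mul0r. Qed.

Lemma cvg_powR_expRN0 a : 0 < a ->
  powR_expRN a t @[t --> 0^'+] --> powR_expRN a 0.
Proof.
move=> a0; rewrite powR_expRN0 ?gt_eqF//.
rewrite -[X in _ --> X](mul0r (expR (- 0))).
apply: cvgM; first exact: powR_cvg0.
apply: cvg_at_right_filter; apply: continuous_comp; first exact: opp_continuous.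
exact: continuous_expR.
Qed.

(* From [t / (2 a) <= expR (t / (2 a))], raised to the power [a]. *)
Lemma powR_expRN_le a t : 0 < a -> 0 <= t ->
  powR_expRN a t <= (2 * a) `^ a * expR (- (2^-1 * t)).
Proof.
move=> a0 t0.
have t2a : t <= (2 * a) * expR (t / (2 * a)).
  rewrite mulrC -ler_pdivrMr ?mulr_gt0//.
  by apply: le_trans (expR_ge1Dx _); rewrite lerDr.
have -> : expR (- (2^-1 * t)) = expR (t / (2 * a)) `^ a * expR (- t) :> R.
  rewrite -expRM -expRD; congr expR.
  by field; rewrite gt_eqF.
rewrite mulrA -powRM ?expR_ge0 ?mulr_ge0 ?(ltW a0)//.
rewrite ler_wpM2r ?expR_ge0// ge0_ler_powR ?nnegrE ?(ltW a0)//.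
by rewrite mulr_ge0 ?expR_ge0// mulr_ge0// ltW.
Qed.

Lemma cvg_expRN2y : expR (- (2^-1 * t)) @[t --> +oo] --> (0 : R).
Proof.
rewrite (_ : (fun t => _) = (fun z : R => expR (- z)) \o (fun z => 2^-1 * z))//.
apply: (@cvg_comp _ _ _ _ _ _ (pinfty_nbhs R)); last exact: cvgr_expR.
by apply: gt0_cvgMry.
Qed.

Lemma cvg_powR_expRNy a : 0 < a -> powR_expRN a t @[t --> +oo] --> (0 : R).
Proof.
move=> a0; apply: (@squeeze_cvgr _ _ _ _ (cst 0)
  (fun t => (2 * a) `^ a * expR (- (2^-1 * t)))).
- near=> t; rewrite powR_expRN_ge0/= powR_expRN_le//.
- exact: cvg_cst.
- rewrite -(mulr0 ((2 * a) `^ a)); apply: cvgM; first exact: cvg_cst.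
  exact: cvg_expRN2y.
Unshelve. all: by end_near. Qed.

Let ge0_integralM a (D : set R) : 0 < a -> measurable D ->
  (a%:E * \int[mu]_(t in D) (powR_expRN (a - 1) t)%:E =
   \int[mu]_(t in D) (a * powR_expRN (a - 1) t)%:E)%E.
Proof.
move=> a0 mD; rewrite -ge0_integralZl_EFin ?ltW//.
- by move=> t _; rewrite lee_fin powR_expRN_ge0.
- apply/measurable_EFinP; apply: measurable_funTS.
  exact: measurable_powR_expRN.
Qed.

Let aM_ge0 a : 0 < a -> forall t, 0 < t -> 0 <= a * powR_expRN (a - 1) t.
Proof. by move=> a0 t _; rewrite mulr_ge0 ?powR_expRN_ge0 ?ltW. Qed.

Let aM_continuous a :
  {in `]0, +oo[%R, continuous (fun t => a * powR_expRN (a - 1) t)}.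
Proof.
move=> t t0; apply: cvgM; first exact: cvg_cst.
exact: continuous_powR_expRN.
Qed.

(** The recurrence of the lower incomplete Gamma function: [t^a e^-t] is a primitive of
    [a t^(a-1) e^-t - t^a e^-t] and vanishes at 0. *)
Lemma integral_powR_expRN_oc a s : 0 < a -> 0 <= s ->
  (a%:E * \int[mu]_(t in `]0%R, s]) (powR_expRN (a - 1) t)%:E =
   \int[mu]_(t in `]0%R, s]) (powR_expRN a t)%:E + (powR_expRN a s)%:E)%E.
Proof.
move=> a0 s0; rewrite ge0_integralM//.
have := ge0_FTC2_oc (aM_ge0 a0) (fun t _ => powR_expRN_ge0 a t)
  (@aM_continuous a) (@continuous_powR_expRN a) (@is_derive_powR_expRN a)
  (cvg_powR_expRN0 a0) s0.
by rewrite powR_expRN0 ?gt_eqF// adde0.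
Qed.

Lemma integral_powR_expRN_oy a : 0 < a ->
  (a%:E * \int[mu]_(t in `]0%R, +oo[) (powR_expRN (a - 1) t)%:E =
   \int[mu]_(t in `]0%R, +oo[) (powR_expRN a t)%:E)%E.
Proof.
move=> a0; rewrite ge0_integralM//.
have := ge0_FTC2_oy (aM_ge0 a0) (fun t _ => powR_expRN_ge0 a t)
  (@aM_continuous a) (@continuous_powR_expRN a) (@is_derive_powR_expRN a)
  (cvg_powR_expRN0 a0) (cvg_powR_expRNy a0).
by rewrite powR_expRN0 ?gt_eqF// !adde0.
Qed.

Lemma integral_powR_expRN_lty a : 0 < a ->
  (\int[mu]_(t in `]0%R, +oo[) (powR_expRN (a - 1) t)%:E < +oo)%E.
Proof.
move=> a0.
(* The recurrence, valid before finiteness is known, raises the exponent from [a - 1] to [a > 0].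
   This removes the possible singularity at 0 and leaves only the decay at infinity. *)
suff : (\int[mu]_(t in `]0%R, +oo[) (powR_expRN a t)%:E < +oo)%E.
  rewrite -integral_powR_expRN_oy//.
  have : (0 <= \int[mu]_(t in `]0%R, +oo[) (powR_expRN (a - 1) t)%:E)%E.
    by apply: integral_ge0 => t _; rewrite lee_fin powR_expRN_ge0.
  by case: (integral _ _ _) => [r| |]// _; rewrite ?ltry// gt0_muley ?lte_fin.
have cE : continuous (fun t : R => expR (- (2^-1 * t))).
  move=> t; apply: continuous_comp; last exact: continuous_expR.
  by apply: cvgN; apply: cvgM; [exact: cvg_cst|exact: cvg_id].
(* The factor 2 compensates the [2^-1] inserted next, which makes the majorant the exact derivative
   of [- c e^(-t/2)]. *)
pose c := (2 * a) `^ a * 2.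
have c0 : 0 <= c by rewrite mulr_ge0 ?powR_ge0.
apply: (@le_lt_trans _ _
    (\int[mu]_(t in `]0%R, +oo[) (c * (2^-1 * expR (- (2^-1 * t))))%:E)%E).
  apply: ge0_le_integral => //=.
  - by move=> t _; rewrite lee_fin powR_expRN_ge0.
  - apply/measurable_EFinP; apply: measurable_funTS.
    exact: measurable_powR_expRN.
  - apply/measurable_EFinP; apply: measurable_funTS.
    apply: measurable_funM => //; apply: measurable_funM => //.
    exact: continuous_measurable_fun.
  - move=> t; rewrite in_itv/= andbT => t0; rewrite lee_fin.
    rewrite (le_trans (powR_expRN_le a0 (ltW t0)))//.
    by rewrite /c -!mulrA mulVKf.
have := @ge0_FTC2_oy _ (fun t => c * (2^-1 * expR (- (2^-1 * t)))) (cst 0)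
  (fun t => - (c * expR (- (2^-1 * t)))) 0 _ _ _ _ _ _ 0 _.
rewrite integral0 add0e => H.
(* An infinite integral plus a real number could not be 0. *)
suff : (\int[mu]_(t in `]0%R, +oo[) (c * (2^-1 * expR (- (2^-1 * t))))%:E
   + (- (c * expR (- (2^-1 * 0))))%:E)%E = 0%E.
  by case: (integral _ _ _) => [r _| |_]; rewrite ?ltry ?ltNyr// addye.
apply: H.
- by move=> t _; apply: mulr_ge0 => //; apply: mulr_ge0; rewrite ?expR_ge0.
- by [].
- move=> t _; apply: cvgM; first exact: cvg_cst.
  by apply: cvgM; [exact: cvg_cst|exact: cE].
- by move=> t _; exact: cvg_cst.
- move=> t _; apply: is_derive_eq.
  by rewrite /= /GRing.scale/=; ring.
- apply: cvg_at_right_filter; apply: cvgN; apply: cvgM; first exact: cvg_cst.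
  exact: cE.
- rewrite -oppr0 -(mulr0 c); apply: cvgN; apply: cvgM; first exact: cvg_cst.
  exact: cvg_expRN2y.
Qed.

Lemma GammaE a : 0 < a ->
  (Gamma a)%:E = (\int[mu]_(t in `]0%R, +oo[) (powR_expRN (a - 1) t)%:E)%E.
Proof.
move=> a0; rewrite /Gamma /Rintegral fineK// ge0_fin_numE.
  exact: integral_powR_expRN_lty.
by apply: integral_ge0 => t _; rewrite lee_fin powR_expRN_ge0.
Qed.

Lemma GammaD1 a : 0 < a -> Gamma (a + 1) = a * Gamma a.
Proof.
move=> a0; apply: EFin_inj; rewrite EFinM !GammaE ?addr_gt0// addrK.
by rewrite integral_powR_expRN_oy.
Qed.

Lemma Gamma_gt0 a : 0 < a -> 0 < Gamma a.
Proof.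
move=> a0; rewrite -(pmulr_rgt0 _ a0) -lte_fin EFinM GammaE//.
(* The boundary term of the incomplete recurrence at [s = 1] is a positive lower bound for
   [a * Gamma a]. *)
apply: (@lt_le_trans _ _ (powR_expRN a 1)%:E).
  by rewrite lte_fin powR_expRN_gt0.
apply: (@le_trans _ _
    (a%:E * \int[mu]_(t in `]0%R, 1%R]) (powR_expRN (a - 1) t)%:E)%E).
  rewrite integral_powR_expRN_oc// leeDr// integral_ge0// => t _.
  by rewrite lee_fin powR_expRN_ge0.
rewrite lee_pmul2l ?lte_fin//; apply: ge0_subset_integral => //=.
- apply/measurable_EFinP; apply: measurable_funTS.
  exact: measurable_powR_expRN.
- by move=> t _; rewrite lee_fin powR_expRN_ge0.
- by move=> t/=; rewrite !in_itv/= andbT => /andP[].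
Qed.

End gamma_integral.

(** * The exponential law *)

Section exponential_law.
Context {R : realType}.
Notation mu := (@lebesgue_measure R).

(** The intervals []a, b]] are differences of half-lines; they are stable under intersection and
    generate the measurable sets, so uniqueness of measures applies. *)
Lemma eq_probability_itvNyc (P1 P2 : probability (measurableTypeR R) R) :
  (forall x : R, P1 `]-oo, x]%classic = P2 `]-oo, x]%classic) ->
  forall A, measurable A -> P1 A = P2 A.
Proof.
move=> P12; apply: (@measure_unique _ _ (measurableTypeR R) (@ocitv R)
  (fun n => `]- n%:R, n%:R]%classic)) => //.
- exact: ocitvI.
- by move=> i; exact: is_ocitv.
- exact: (bigcup_itvT false false).
- move=> _ [[a b] _ <-] /=.
  have [ab|ba] := leP a b; last first.
    by rewrite set_itv_ge ?measure0// bnd_simp -leNgt ltW.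
  have -> : `]a, b]%classic = `]-oo, b] `\` `]-oo, a] :> set R.
    apply/seteqP; split => x /=; rewrite !in_itv/=.
      by move=> /andP[ax ->]; split=> //; apply/negP; rewrite -ltNge.
    by move=> [-> /negP]; rewrite -ltNge => ->.
  have PD (P : probability (measurableTypeR R) R) :
      P (`]-oo, b] `\` `]-oo, a]) =
      (P `]-oo, b]%classic - P `]-oo, a]%classic)%E.
    rewrite measureD ?setIidr//; first by apply: subset_itvl; rewrite bnd_simp.
    by rewrite -ge0_fin_numE// fin_num_measure.
  by rewrite !PD !P12.
- by move=> k; rewrite -ge0_fin_numE// fin_num_measure.
Qed.

Local Notation expP := (@exponential_prob R 1).

Lemma exponential_prob_itvNyc (x : R) : 0 <= x ->
  expP `]-oo, x] = (1 - (expR (- x))%:E)%E.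
Proof.
move=> x0.
have -> : `]-oo, x]%classic = `]-oo, 0[ `|` `[0, x] :> set R.
  by rewrite -itv_bndbnd_setU ?bnd_simp.
rewrite measureU//; last first.
  apply/seteqP; split => // y []/=; rewrite !in_itv/= => y0 /andP[+ _].
  by rewrite leNgt y0.
rewrite [X in (X + _ = _)%E](_ : _ = 0%E) ?add0e; last first.
  rewrite /= /exponential_prob; apply: integral0_eq => y.
  rewrite /= in_itv/= => y0.
  by rewrite lt0_exponential_pdf.
move: x0; rewrite le_eqVlt => /predU1P[<-|x0].
  by rewrite oppr0 expR0 subee// set_itv1 /= /exponential_prob integral_set1.
by rewrite /= exponential_prob_itv0c// mulN1r.
Qed.

Lemma exponential_prob_itvNyc_lt0 (x : R) : x < 0 -> expP `]-oo, x] = 0%E.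
Proof.
move=> x0; rewrite /exponential_prob; apply: integral0_eq => y.
rewrite /= in_itv/= => yx.
by rewrite lt0_exponential_pdf// (le_lt_trans yx).
Qed.

Lemma exponential_prob_dom : expP `<< mu.
Proof.
apply/null_content_dominatesP => A mA A0; rewrite /exponential_prob.
apply: null_set_integral => //.
apply/measurable_EFinP; apply: measurable_funTS.
exact: measurable_exponential_pdf.
Qed.

Lemma ge0_integral_exponential_prob (D : set R) (f : R -> R) :
  measurable D -> measurable_fun [set: R] f -> (forall x, 0 <= f x) ->
  (\int[expP]_(x in D) (f x)%:E =
   \int[mu]_(x in D `&` `]0%R, +oo[) (f x * expR (- x))%:E)%E.
Proof.
move=> mD mf f0.
have mp : measurable_fun [set: R] (EFin \o exponential_pdf (1:R)).
  by apply/measurable_EFinP; exact: measurable_exponential_pdf.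
have mEf : measurable_fun [set: R] (EFin \o f) by exact/measurable_EFinP.
rewrite -(Radon_Nikodym_SigmaFinite.change_of_variables exponential_prob_dom)//;
  last first.
  exact: measurable_funTS.
transitivity (\int[mu]_(x in D) ((f x)%:E * (exponential_pdf 1 x)%:E))%E.
  apply: ge0_ae_eq_integral => //.
  - apply: emeasurable_funM; first exact: measurable_funTS.
    apply: (measurable_int mu); apply: (integrableS _ _ (@subsetT _ _)) => //.
    exact: Radon_Nikodym_SigmaFinite.f_integrable exponential_prob_dom.
  - by apply: emeasurable_funM; exact: measurable_funTS.
  - move=> x _; rewrite mule_ge0 ?lee_fin//.
    exact: Radon_Nikodym_SigmaFinite.f_ge0 exponential_prob_dom _.
  - by move=> x _; rewrite mule_ge0 ?lee_fin// exponential_pdf_ge0.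
  (* The Radon-Nikodym derivative and the explicit density have the same integral over every
     measurable set, so they agree almost everywhere. *)
  apply: ae_eqe_mul2l; apply: integral_ae_eq => //.
  - apply: (integrableS _ _ (@subsetT _ _)) => //.
    exact: Radon_Nikodym_SigmaFinite.f_integrable exponential_prob_dom.
  - exact: measurable_funTS.
  - move=> E ED mE.
    by rewrite -(Radon_Nikodym_SigmaFinite.f_integral exponential_prob_dom).
transitivity (\int[mu]_(x in D `&` `[0%R, +oo[) (f x * expR (- x))%:E)%E.
  rewrite integral_mkcondr; apply: eq_integral => x _.
  rewrite patchE -EFinM; case: ifPn => [|xN].
    rewrite inE/= in_itv/= andbT => x0.
    by rewrite exponential_pdfE// !mul1r mulN1r.
  rewrite lt0_exponential_pdf ?mulr0//.
  by move: xN; rewrite notin_setE/= in_itv/= andbT => /negP; rewrite -ltNge.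
have -> : D `&` `]0, +oo[ = (D `&` `[0, +oo[) `\ 0 :> set R.
  apply/seteqP; split => x/=; rewrite !in_itv/= !andbT lt_neqAle eq_sym.
    by move=> [Dx /andP[/eqP ? ->]].
  by move=> [[Dx ->] /eqP ->].
rewrite integral_setD1//; first by apply: measurableD => //; exact: measurableI.
apply/measurable_EFinP; apply: measurable_funTS; apply: measurable_funM => //.
by apply: measurableT_comp => //; exact: measurable_expR.
Qed.

End exponential_law.

(** * Distribution functions *)

Section cdfR_theory.
Context d (T : measurableType d) (R : realType) (P : probability T R).
Variable X : {RV P >-> R}.
Local Notation F := (cdfR X).

Lemma cdfRE x : (F x)%:E = P [set w | X w <= x].
Proof.
by rewrite /cdfR fineK ?fin_num_measure.
Qed.

Lemma measurable_RV_le x : measurable [set w | X w <= x].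
Proof.
have -> : [set w | X w <= x] = X @^-1` `]-oo, x].
  by apply/seteqP; split => w; rewrite /= in_itv.
exact: measurable_funPTI.
Qed.

Lemma measurable_RV_gt x : measurable [set w | x < X w].
Proof.
have -> : [set w | x < X w] = X @^-1` `]x, +oo[.
  by apply/seteqP; split => w; rewrite /= in_itv/= andbT.
exact: measurable_funPTI.
Qed.

Lemma measurable_RV_lt x : measurable [set w | X w < x].
Proof.
have -> : [set w | X w < x] = X @^-1` `]-oo, x[.
  by apply/seteqP; split => w; rewrite /= in_itv.
exact: measurable_funPTI.
Qed.

Lemma cdfR_ge0 x : 0 <= F x.
Proof. exact: fine_ge0. Qed.

Lemma cdfR_le1 x : F x <= 1.
Proof.
by rewrite -lee_fin cdfRE probability_le1//; exact: measurable_RV_le.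
Qed.

Lemma cdfR_nd : {homo F : x y / x <= y}.
Proof.
by move=> x y xy; rewrite fine_le ?fin_num_measure// cdf_nondecreasing.
Qed.

Lemma measurable_cdfR : measurable_fun [set: R] F.
Proof. by apply: nondecreasing_measurable => // x y; exact: cdfR_nd. Qed.

Lemma cdfR_gtE x : P [set w | x < X w] = (1 - (F x)%:E)%E.
Proof.
rewrite cdfRE -probability_setC; last exact: measurable_RV_le.
congr (P _); apply/seteqP; split => w /=; first by rewrite ltNge => /negP.
by move/negP; rewrite -ltNge.
Qed.

Lemma cdfR_right_continuous : right_continuous F.
Proof.
move=> x; apply: fine_cvg; rewrite fineK ?fin_num_measure//.
exact: cdf_right_continuous.
Qed.

(** The quantile is the infimum of the points where [F] is at least [v]. The limits of [F] at both
    infinities make this set nonempty and bounded below, and right continuity puts the infimum in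
    it. *)
Lemma cdfR_quantile v : 0 < v < 1 ->
  exists2 x0, v <= F x0 & forall z, z < x0 -> F z < v.
Proof.
move=> /andP[v0 v1].
have F1 : F x @[x --> +oo] --> (1 : R) by exact/fine_cvg/cvg_cdfy1.
have F0 : F x @[x --> -oo] --> (0 : R) by exact/fine_cvg/cvg_cdfNy0.
pose S := [set x | v <= F x].
have S0 : S !=set0.
  near (pinfty_nbhs R) => x; exists x; apply/ltW; near: x.
  exact: cvgr_gt F1 _ v1.
have [m mP] : exists m, F m < v.
  near (ninfty_nbhs R) => x; exists x; near: x.
  exact: cvgr_lt F0 _ v0.
have lS : has_lbound S.
  exists m => x Sx; rewrite leNgt; apply/negP => xm.
  by have := lt_le_trans mP Sx; rewrite ltNge (cdfR_nd (ltW xm)).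
exists (inf S).
  rewrite leNgt; apply/negP => Fv.
  near (inf S)^'+ => y.
  have Fy : F y < v by near: y; exact: cvgr_lt (@cdfR_right_continuous _) _ Fv.
  have : inf S < y by near: y; exact: nbhs_right_gt.
  move=> /inf_lt-/(_ S0)[s Ss sy].
  by have := le_lt_trans (le_trans Ss (cdfR_nd (ltW sy))) Fy; rewrite ltxx.
move=> z zS; rewrite ltNge; apply/negP => vz.
by have := ge_inf lS vz; rewrite leNgt zS.
Unshelve. all: by end_near. Qed.

(** The quantile [x0] of level [v] works: without an atom, [F x0] is the probability of [X < x0],
    the limit of [F (x0 - 1/(n+1))], and each of these values is below [v]. *)
Lemma cdfR_atomless_surj v : (forall x, P [set w | X w = x] = 0%E) ->
  0 < v < 1 -> exists x, F x = v.
Proof.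
move=> P0 /cdfR_quantile[x0 vF Fv]; exists x0; apply/eqP.
rewrite eq_le vF andbT.
pose B := [set w | X w < x0].
have -> : F x0 = fine (P B).
  rewrite -[LHS]/(fine (F x0)%:E) cdfRE; congr fine.
  have -> : [set w | X w <= x0] = B `|` [set w | X w = x0].
    apply/seteqP; split => w /=.
      by rewrite le_eqVlt => /predU1P[->|]; [right|left].
    by move=> [/ltW//|->].
  rewrite measureU0//; last exact: P0.
    exact: measurable_RV_lt.
  exact: (measurable_funPTI X (measurable_set1 x0)).
pose A n := [set w | X w <= x0 - n.+1%:R^-1].
have -> : B = \bigcup_n A n.
  apply/seteqP; split => w /=.
    move=> Xx; have : 0 < x0 - X w by rewrite subr_gt0.
    move=> /ltr_add_invr[n]; rewrite add0r => nX; exists n => //.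
    by rewrite /A/= lerBrDr -lerBrDl ltW.
  move=> [n _]; rewrite /A/= => /le_lt_trans; apply.
  by rewrite ltrBlDr ltrDl invr_gt0 ltr0n.
have mA n : measurable (A n) by exact: measurable_RV_le.
have PA : P (A n) @[n --> \oo] --> P (\bigcup_n A n).
  apply: nondecreasing_cvg_mu => //; first exact: bigcup_measurable.
  move=> n m nm; apply/subsetPset => w /= /le_trans; apply.
  by rewrite lerD2l lerN2 lef_pV2 ?posrE ?ltr0n// ler_nat.
rewrite -lee_fin fineK ?fin_num_measure//; last exact: bigcup_measurable.
rewrite -(cvg_lim _ PA)//; apply: lime_le.
  by apply/cvg_ex; eexists; exact: PA.
apply: nearW => n; rewrite -cdfRE lee_fin ltW// Fv//.
by rewrite ltrBlDr ltrDl invr_gt0 ltr0n.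
Qed.

(* If [F x < 1], a quantile of level strictly between [F x] and 1 is a point of
   the support that is at least [x]. *)
Lemma support_le_cdfR l x :
  law_support X `<=` [set y | y <= l] -> l < x -> F x = 1.
Proof.
move=> sl lx; apply/eqP; rewrite eq_le cdfR_le1 leNgt; apply/negP => Fx1.
have [|x0 vF Fv] := @cdfR_quantile ((F x + 1) / 2).
  by have F0 := cdfR_ge0 x; apply/andP; split; lra.
have xx0 : x <= x0.
  rewrite leNgt; apply/negP => /ltW/cdfR_nd.
  by move: Fx1 vF; lra.
suff /sl : law_support X x0.
  by move=> x0l; have := lt_le_trans lx (le_trans xx0 x0l); rewrite ltxx.
move=> U oU Ux0.
have [e /= e0 eU] : exists2 e : R, 0 < e & ball x0 e `<=` U.
  by have /nbhs_ballP := open_nbhs_nbhs (conj oU Ux0).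
(* The law gives []x0 - e/2, x0]], which lies in the ball, the positive mass
   [F x0 - F (x0 - e/2)]. *)
apply: (@lt_le_trans _ _ ((F x0)%:E - (F (x0 - e / 2))%:E)%E).
  rewrite -EFinB lte_fin subr_gt0 (lt_le_trans (Fv _ _))//.
  by rewrite ltrBlDr ltrDl divr_gt0.
rewrite !cdfRE -[X in (_ - X)%E](_ : P ([set w | X w <= x0] `&`
  [set w | X w <= x0 - e / 2]) = _); last first.
  congr (P _); apply/seteqP; split => w /=; first by case.
  by move=> Xw; split=> //; rewrite (le_trans Xw)// lerBlDr lerDl divr_ge0 ?ltW.
rewrite -measureD; [|exact: measurable_RV_le..|]; last first.
  by rewrite -ge0_fin_numE// fin_num_measure//; exact: measurable_RV_le.
apply: le_measure; rewrite ?inE.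
- by apply: measurableD; exact: measurable_RV_le.
- by apply: measurable_funPTI => //; exact: open_measurable.
- move=> w /= [Xx0 /negP]; rewrite -ltNge => xX; apply: eU.
  by rewrite /ball/= ger0_norm ?subr_ge0//; lra.
Qed.

End cdfR_theory.

(** * Tail integrals and the probability integral transform *)

Section tail_integral.
Context d (T : measurableType d) (R : realType) (P : probability T R).
Variables (W : {RV P >-> R}) (phi : T -> R).
Hypothesis mphi : measurable_fun [set: T] phi.
Hypothesis phi0 : forall w, 0 <= phi w.
Notation mu := (@lebesgue_measure R).

Let f (p : T * measurableTypeR R) : \bar R :=
  (if (0 < p.2) && (p.2 < W p.1) then phi p.1 else 0)%:E.

Let f0 p : (0 <= f p)%E.
Proof. by rewrite /f lee_fin; case: ifP. Qed.

Let mf : measurable_fun [set: T * measurableTypeR R] f.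
Proof.
apply/measurable_EFinP; apply: measurable_fun_ifT => //.
- apply: measurable_and.
    by apply: measurable_fun_ltr => //; exact: measurable_snd.
  apply: measurable_fun_ltr; first exact: measurable_snd.
  by apply: measurableT_comp => //; exact: measurable_fst.
- by apply: measurableT_comp => //; exact: measurable_fst.
Qed.

Let fubini_GE x : 0 < x ->
  fubini_G P f x = (\int[P]_(w in [set w | (x < W w)%R]) (phi w)%:E)%E.
Proof.
move=> x0; rewrite integral_mkcond /fubini_G; apply: eq_integral => w _.
rewrite /f/= x0 /= patchE; case: ifPn => xW; first by rewrite mem_set.
by rewrite memNset//; exact/negP.
Qed.

Lemma measurable_tail_integral : measurable_fun (`]0, +oo[%classic : set R)
  (fun x => \int[P]_(w in [set w | (x < W w)%R]) (phi w)%:E)%E.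
Proof.
apply: (@eq_measurable_fun _ _ _ _ _ (fubini_G P f)).
  by move=> x; rewrite inE/= in_itv/= andbT => x0; rewrite fubini_GE.
by apply: measurable_funTS; exact: measurable_fun_fubini_tonelli_G.
Qed.

(** Layer-cake formula: after Tonelli, the inner integral measures the [x] in []0, W w[], an
    interval of length the positive part of [W w]. *)
Lemma integral_tail_integral :
  (\int[mu]_(x in `]0%R, +oo[) \int[P]_(w in [set w | (x < W w)%R]) (phi w)%:E =
   \int[P]_w (phi w * Num.max 0 (W w))%:E)%E.
Proof.
transitivity (\int[mu]_x fubini_G P f x)%E.
  rewrite integral_mkcond; apply: eq_integral => x _.
  rewrite patchE; case: ifPn => [|xN].
    by rewrite inE/= in_itv/= andbT => x0; rewrite fubini_GE.
  rewrite /fubini_G integral0_eq// => w _; rewrite /f/=.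
  by move: xN; rewrite notin_setE/= in_itv/= andbT => /negP/negbTE ->.
rewrite -(@fubini_tonelli _ _ _ _ _ P mu f)//; apply: eq_integral => w _.
transitivity (\int[mu]_(x in `]0%R, W w[) (phi w)%:E)%E.
  rewrite [RHS]integral_mkcond; apply: eq_integral => x _.
  rewrite patchE /f/=; case: ifPn => xW; first by rewrite mem_set//= in_itv.
  by rewrite memNset//= in_itv/=; exact/negP.
rewrite integral_cst//= lebesgue_measure_itv/= lte_fin EFinM; congr (_ * _)%E.
by case: ltP => W0; rewrite ?oppr0 ?adde0.
Qed.

End tail_integral.

Section probability_integral_transform.
Context d (T : measurableType d) (R : realType) (P : probability T R).
Variable W : {RV P >-> R}.
Local Notation G := (cdfR W).
Notation mu := (@lebesgue_measure R).
Hypothesis G_surj : forall v, 0 < v < 1 -> exists x, G x = v.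

(* The codomain is [measurableTypeR R], not [R], so that [distribution P U] has
   the type of [exponential_prob].  Where [G (W w) = 0], a null event, [U w] has
   the junk value 0 since [ln 0 = 0]. *)
Definition Nln_cdf (w : T) : measurableTypeR R := - ln (G (W w)).
Local Notation U := Nln_cdf.

Lemma measurable_cdfW : measurable_fun [set: T] (fun w => G (W w)).
Proof. by apply: measurableT_comp => //; exact: measurable_cdfR. Qed.

Lemma measurable_Nln_cdf : measurable_fun [set: T] U.
Proof.
apply: measurableT_comp => //; apply: measurableT_comp.
  exact: measurable_ln.
exact: measurable_cdfW.
Qed.

Lemma Nln_cdf_ge0 w : 0 <= U w.
Proof. by rewrite oppr_ge0 ln_le0// cdfR_le1. Qed.

HB.instance Definition _ :=
  isMeasurableFun.Build _ _ T (measurableTypeR R) U measurable_Nln_cdf.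

Let mcdf_lt v : measurable [set w | G (W w) < v].
Proof.
have := measurable_cdfW measurableT (measurable_itv `]-oo, v[).
by rewrite setTI; congr measurable; apply/seteqP; split => w /=; rewrite in_itv.
Qed.

Let mcdf_le v : measurable [set w | G (W w) <= v].
Proof.
have := measurable_cdfW measurableT (measurable_itv `]-oo, v]).
by rewrite setTI; congr measurable; apply/seteqP; split => w /=; rewrite in_itv.
Qed.

Let P_cdf_lt_ge u v : 0 < u < 1 -> u < v ->
  (u%:E <= P [set w | (G (W w) < v)%R])%E.
Proof.
move=> /G_surj[x <-] xv; rewrite cdfRE; apply: le_measure; rewrite ?inE//.
  exact: measurable_RV_le.
by move=> w /= /cdfR_nd/le_lt_trans; exact.
Qed.

(** Uniformity of [G(W)]. For the upper bound when [v < 1], take [x] with [G x = v]; then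
    [G (W w) < v] forces [W w <= x]. The lower bound comes from levels [u < v]. *)
Lemma cdfR_cdf_lt v : 0 < v <= 1 -> P [set w | G (W w) < v] = v%:E.
Proof.
move=> /andP[v0 v1]; apply/eqP; rewrite eq_le; apply/andP; split.
  have /predU1P[->|{}v1] : (v == 1) || (v < 1) by rewrite -le_eqVlt.
    exact: probability_le1.
  have [|x <-] := G_surj (v := v); first by rewrite v0.
  rewrite cdfRE; apply: le_measure; rewrite ?inE//.
    exact: measurable_RV_le.
  move=> w /= ; rewrite ltNge => /negP GW; rewrite leNgt; apply/negP => xW.
  by apply: GW; exact/cdfR_nd/ltW.
have fP : P [set w | G (W w) < v] \is a fin_num by rewrite fin_num_measure.
have p0 : 0 <= fine (P [set w | G (W w) < v]) by exact: fine_ge0.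
rewrite -(fineK fP) lee_fin leNgt; apply/negP => pv.
(* If the probability were below [v], the midpoint between the two would be an admissible level [u]
   exceeding it. *)
have : (fine (P [set w | G (W w) < v]) + v) / 2 <=
    fine (P [set w | G (W w) < v]).
  rewrite -lee_fin [leRHS]fineK//; apply: P_cdf_lt_ge; last lra.
  by apply/andP; split; lra.
lra.
Qed.

(** For every [e] in []0, 1]] this event lies in [G (W w) < e], of probability [e]. *)
Lemma cdfR_cdf_le0 : P [set w | G (W w) <= 0] = 0%E.
Proof.
apply/eqP; rewrite eq_le measure_ge0 andbT; apply/lee_addgt0Pr => e e0.
rewrite add0e.
have [e1|e1] := leP e 1; last first.
  by rewrite (le_trans (probability_le1 _ _))// lee_fin ltW.
rewrite -[leRHS](@cdfR_cdf_lt e) ?e0//.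
by apply: le_measure; rewrite ?inE// => w /= /le_lt_trans; exact.
Qed.

Lemma Nln_cdf_law (A : set R) : measurable A ->
  distribution P U A = @exponential_prob R 1 A.
Proof.
move: A; apply: (@eq_probability_itvNyc _ (distribution P U)
  (@exponential_prob R 1)) => t.
rewrite -[LHS]/(P (U @^-1` `]-oo, t])) -[RHS]/(exponential_prob 1 `]-oo, t]).
have [t0|t0] := leP 0 t; last first.
  rewrite exponential_prob_itvNyc_lt0//.
  rewrite (_ : _ @^-1` _ = set0) ?measure0//; apply/seteqP; split => // w /=.
  by rewrite in_itv/= leNgt (lt_le_trans t0)// Nln_cdf_ge0.
rewrite exponential_prob_itvNyc//.
(* The points with [G (W w) <= 0] are taken out because there [U] is 0, hence at most [t]; they form
   a null set. *)
have -> : U @^-1` `]-oo, t] = ~` ([set w | G (W w) < expR (- t)] `\`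
    [set w | G (W w) <= 0]).
  apply/seteqP; split => w /=; rewrite in_itv/= /U.
    move=> Ut [Gt /negP]; rewrite -ltNge => G0; move: Ut.
    by rewrite lerNl leNgt -[X in _ < X](@expRK R) ltr_ln ?posrE ?expR_gt0// Gt.
  move=> /not_andP[/negP|/contrapT G0].
    rewrite -leNgt => tG; rewrite lerNl -[leLHS](@expRK R).
    by rewrite ler_ln ?posrE ?expR_gt0 ?(lt_le_trans _ tG)// expR_gt0.
  by rewrite ln0// oppr0.
rewrite probability_setC; last exact: measurableD.
rewrite measureD//; last by rewrite -ge0_fin_numE// fin_num_measure.
congr (1 - _)%E; rewrite [X in (_ - X)%E](_ : _ = 0%E) ?sube0.
  by apply: cdfR_cdf_lt; rewrite expR_gt0 expR_le1 oppr_le0.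
by apply: (subset_measure0 _ _ _ cdfR_cdf_le0) => //; exact: measurableI.
Qed.

Lemma ge0_expectation_Nln_cdf (D : set R) (f : R -> R) : measurable D ->
  measurable_fun [set: R] f -> (forall x, 0 <= f x) ->
  (\int[P]_(w in U @^-1` D) (f (U w))%:E =
   \int[mu]_(t in D `&` `]0%R, +oo[) (f t * expR (- t))%:E)%E.
Proof.
move=> mD mf f0; rewrite -ge0_integral_exponential_prob//.
transitivity (\int[distribution P U]_(x in D) (f x)%:E)%E.
  rewrite ge0_integral_pushforward//.
  - by apply/measurable_EFinP; exact: measurable_funTS.
  - by move=> y _; rewrite lee_fin.
by apply: eq_measure_integral => A mA _; exact: Nln_cdf_law.
Qed.

End probability_integral_transform.

(** * The entropy identity *)

Lemma ge0_integral_subset_full d (T : measurableType d) (R : realType)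
    (P : probability T R) (A B : set T) (f : T -> \bar R) :
  measurable A -> measurable B -> A `<=` B -> P A = P B ->
  measurable_fun B f -> (forall x, B x -> 0 <= f x)%E ->
  (\int[P]_(x in A) f x = \int[P]_(x in B) f x)%E.
Proof.
move=> mA mB AB PAB mf f0.
rewrite [RHS](@ge0_negligible_integral _ _ _ _ _ (B `\` A))//.
- by rewrite setDD setIidr.
- exact: measurableD.
- rewrite measureD//; last by rewrite -ge0_fin_numE// fin_num_measure.
  rewrite setIidr// [X in (_ - X)%E](_ : _ = P B)//.
  by rewrite subee// fin_num_measure.
Qed.

Section entropy_identity.
Context d (T : measurableType d) (R : realType) (P : probability T R).
Variables (W : {RV P >-> R}) (a : R).
Local Notation G := (cdfR W).
Local Notation U := (Nln_cdf W).
Notation mu := (@lebesgue_measure R).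
Hypothesis G_surj : forall v, 0 < v < 1 -> exists x, G x = v.
Hypothesis a0 : 0 < a.

Let mpowU b : measurable_fun [set: T] (fun w => U w `^ b).
Proof.
apply: (measurableT_comp (@measurable_powR R b)).
exact: (measurable_Nln_cdf W).
Qed.

Let tail b x := (\int[P]_(w in [set w | (x < W w)%R]) (U w `^ b)%:E)%E.
Let entropy x := G x * (- ln (G x)) `^ a.

Let tail_ge0 b x : (0 <= tail b x)%E.
Proof. by apply: integral_ge0 => w _; rewrite lee_fin powR_ge0. Qed.

Let entropy_ge0 x : 0 <= entropy x.
Proof. by rewrite mulr_ge0 ?powR_ge0// cdfR_ge0. Qed.

Let mentropy : measurable_fun [set: R] entropy.
Proof.
have mG := measurable_cdfR W.
apply: measurable_funM => //.
apply: (measurableT_comp (@measurable_powR R a)); apply: measurableT_comp => //.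
by apply: (measurableT_comp (@measurable_ln R)).
Qed.

(** Inclusion and equal probability replace equality of events: where [G] is flat to the left of
    [x], the event on [U] can also contain points with [W w <= x]. *)
Let tailE (b x : R) (D : set R) : measurable D ->
  [set w | x < W w] `<=` U @^-1` D -> P [set w | x < W w] = P (U @^-1` D) ->
  tail b x = (\int[mu]_(t in D `&` `]0%R, +oo[) (powR_expRN b t)%:E)%E.
Proof.
move=> mD WD PWD.
rewrite -(@ge0_expectation_Nln_cdf _ _ _ P W G_surj D (@powR R ^~ b))//.
- apply: ge0_integral_subset_full => //.
  + exact: measurable_RV_gt.
  + by rewrite -[X in measurable X]setTI; exact: (measurable_Nln_cdf W).
  + by apply/measurable_EFinP; exact: measurable_funTS.
  + by move=> w _; rewrite lee_fin powR_ge0.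
- by move=> t; exact: powR_ge0.
Qed.

Lemma tail_Nln_cdf x : (a%:E * tail (a - 1) x = tail a x + (entropy x)%:E)%E.
Proof.
(* If [G x = 0], no real [s] satisfies [e^-s = G x]. The tail event then has probability 1, and the
   complete Gamma recurrence is used with a vanishing entropy term. *)
have /orP[/eqP G0|G0] : (G x == 0) || (0 < G x).
  by rewrite -le0r cdfR_ge0.
  have TE b : tail b x = (\int[mu]_(t in `]0%R, +oo[) (powR_expRN b t)%:E)%E.
    rewrite (@tailE _ _ setT)//; first by rewrite setTI.
    by rewrite preimage_setT cdfR_gtE G0 sube0 probability_setT.
  by rewrite !TE integral_powR_expRN_oy// /entropy G0 mul0r adde0.
pose s := - ln (G x).
have s0 : 0 <= s by rewrite oppr_ge0 ln_le0// cdfR_le1.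
have es : expR (- s) = G x by rewrite opprK lnK.
have TE b : tail b x = (\int[mu]_(t in `]0%R, s]) (powR_expRN b t)%:E)%E.
  rewrite (@tailE _ _ `]-oo, s])//.
  - congr integral; apply/seteqP; split => t /=; rewrite !in_itv/= ?andbT.
      by move=> [-> ->].
    by move=> /andP[].
  - move=> w /= xW; rewrite in_itv/= /s lerN2.
    have GxW : G x <= G (W w) by apply: cdfR_nd; exact: ltW.
    by rewrite ler_ln ?posrE// (lt_le_trans G0).
  - rewrite cdfR_gtE.
    rewrite -[RHS]/(distribution P (U : {mfun T >-> measurableTypeR R}) _).
    by rewrite Nln_cdf_law// exponential_prob_itvNyc// es.
rewrite !TE integral_powR_expRN_oc//; congr (_ + _%:E)%E.
by rewrite /powR_expRN es mulrC.
Qed.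

(** Over the whole space the integral is the moment of order [b - 1] of a standard exponential
    variable, which is [Gamma b]. *)
Let tail_le b x : 0 < b -> (tail (b - 1) x <= (Gamma b)%:E)%E.
Proof.
move=> b0; rewrite GammaE//.
have -> : (\int[mu]_(t in `]0%R, +oo[) (powR_expRN (b - 1) t)%:E =
    \int[P]_w (U w `^ (b - 1))%:E)%E.
  have := @ge0_expectation_Nln_cdf _ _ _ P W G_surj setT (@powR R ^~ (b - 1)).
  rewrite setTI preimage_setT => -> //.
  by move=> t; exact: powR_ge0.
apply: ge0_subset_integral => //.
- exact: measurable_RV_gt.
- exact/measurable_EFinP.
- by move=> w _; rewrite lee_fin powR_ge0.
Qed.

Let mtail b : measurable_fun (`]0, +oo[%classic : set R) (tail b).
Proof. by apply: measurable_tail_integral => // w; exact: powR_ge0. Qed.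

Lemma integral_tail_Nln_cdf :
  (a%:E * \int[P]_w (U w `^ (a - 1) * Num.max 0 (W w))%:E =
   \int[P]_w (U w `^ a * Num.max 0 (W w))%:E +
   \int[mu]_(x in `]0%R, +oo[) (entropy x)%:E)%E.
Proof.
rewrite -!integral_tail_integral; [|by []|by move=> w; exact: powR_ge0
  |by []|by move=> w; exact: powR_ge0].
rewrite -ge0_integralZl//; [|exact: mtail|by move=> x _; exact: tail_ge0
  |by rewrite lee_fin ltW].
under eq_integral do rewrite tail_Nln_cdf.
rewrite ge0_integralD//.
- exact: mtail.
- by move=> x _; rewrite lee_fin.
- by apply/measurable_EFinP; exact: measurable_funTS.
Qed.

(** The range of [x] is cut at a point [x1]: on []0, x1]] the tail is at most [Gamma a], and beyond
    [x1] it is at most [2/a] times the entropy integrand. *)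
Lemma integral_Nln_cdf_lty :
  (\int[mu]_(x in `]0%R, +oo[) (entropy x)%:E < +oo)%E ->
  (\int[P]_w (U w `^ (a - 1) * Num.max 0 (W w))%:E < +oo)%E.
Proof.
move=> Ioo.
have [x1 x10 Gx1] : exists2 x1, 0 < x1 & expR (- (a / 2)) < G x1.
  have G1 : G x @[x --> +oo] --> (1 : R) by exact/fine_cvg/cvg_cdfy1.
  have e1 : expR (- (a / 2)) < 1 by rewrite expR_lt1 oppr_lt0 divr_gt0.
  have [M [_ MG]] := cvgr_gt _ G1 _ e1.
  exists (Num.max M 0 + 1); first by rewrite ltr_wpDl// le_max lexx orbT.
  by apply: MG; rewrite ltr_pwDr// le_max lexx.
have tail_entropy x : x1 <= x -> (tail (a - 1) x <= (2 / a * entropy x)%:E)%E.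
  move=> x1x.
  have tS : (tail a x <= (a / 2)%:E * tail (a - 1) x)%E.
    rewrite /tail -ge0_integralZl//; last 4 first.
    - exact: measurable_RV_gt.
    - by apply/measurable_EFinP; exact: measurable_funTS.
    - by move=> w _; rewrite lee_fin powR_ge0.
    - by rewrite lee_fin divr_ge0// ltW.
    apply: ge0_le_integral.
    - exact: measurable_RV_gt.
    - by move=> w _; rewrite lee_fin powR_ge0.
    - by apply/measurable_EFinP; exact: measurable_funTS.
    - apply/measurable_EFinP; apply: measurable_funTS.
      by apply: measurable_funM.
    (* Write [U^a = U U^(a-1)] and use [U <= a/2], which holds since [G (W w) > e^(-a/2)] beyond
       [x1]. *)
    - move=> w /= xW; rewrite -EFinM lee_fin -mulr_powRB1 ?Nln_cdf_ge0//.
      rewrite ler_wpM2r ?powR_ge0// lerNl -[leLHS](@expRK R).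
      have GW : expR (- (a / 2)) < G (W w).
        by rewrite (lt_le_trans Gx1)// cdfR_nd// (le_trans x1x)// ltW.
      by rewrite ler_ln ?posrE ?expR_gt0 ?ltW// (lt_trans _ GW) ?expR_gt0.
  have := tail_Nln_cdf x.
  (* Finite tails turn the extended identity into a real one, where half of [a * tail (a - 1) x]
     absorbs [tail a x]. *)
  have tfin : tail (a - 1) x \is a fin_num.
    by rewrite ge0_fin_numE// (le_lt_trans (tail_le _ a0))// ltry.
  have tfin' : tail a x \is a fin_num.
    rewrite ge0_fin_numE// (le_lt_trans tS)// -(fineK tfin) -EFinM ltry//.
  move: tS; rewrite -(fineK tfin) -(fineK tfin') -!EFinM -EFinD !lee_fin.
  move=> S [E].
  rewrite -(ler_pM2l (divr_gt0 a0 (ltr0n _ 2))) mulrA.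
  have -> : a / 2 * (2 / a) = 1 by field; rewrite gt_eqF.
  lra.
rewrite -integral_tail_integral//; last by move=> w; exact: powR_ge0.
have itvE : `]0, +oo[%classic = `]0, x1] `|` `]x1, +oo[ :> set R.
  by rewrite -itv_bndbnd_setU ?bnd_simp// ltW.
rewrite {1}itvE.
have s1 : (`]0, x1]%classic : set R) `<=` `]0, +oo[.
  by move=> t; rewrite /= !in_itv/= andbT => /andP[].
have s2 : (`]x1, +oo[%classic : set R) `<=` `]0, +oo[.
  by move=> t; rewrite /= !in_itv/= !andbT; exact: lt_trans.
rewrite ge0_integral_setU//=; last 3 first.
- by rewrite -itvE; exact: mtail.
- by move=> x _; exact: tail_ge0.
- apply/disj_setPS => t [/=]; rewrite !in_itv/= andbT => /andP[_].
  by move=> /le_lt_trans/[apply]; rewrite ltxx.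
apply: lte_add_pinfty.
  apply: (@le_lt_trans _ _ (\int[mu]_(x in `]0%R, x1]) (Gamma a)%:E)%E).
    apply: ge0_le_integral => //.
    - by move=> x _; exact: tail_ge0.
    - exact: (measurable_funS (measurable_itv _) s1 (mtail (a - 1))).
    - by move=> x _; exact: tail_le.
  rewrite integral_cst//= lebesgue_measure_itv/= lte_fin x10.
  by rewrite -EFinD -EFinM ltry.
apply: (@le_lt_trans _ _
    ((2 / a)%:E * \int[mu]_(x in `]0%R, +oo[) (entropy x)%:E)%E).
  rewrite -ge0_integralZl//; last 3 first.
  - by apply/measurable_EFinP; exact: measurable_funTS.
  - by move=> x _; rewrite lee_fin.
  - by rewrite lee_fin divr_ge0// ltW.
  apply: (@le_trans _ _
      (\int[mu]_(x in `]x1, +oo[) ((2 / a)%:E * (entropy x)%:E))%E).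
    apply: ge0_le_integral => //.
    - by move=> x _; exact: tail_ge0.
    - exact: (measurable_funS (measurable_itv _) s2 (mtail (a - 1))).
    - apply: measurable_funeM; apply/measurable_EFinP; exact: measurable_funTS.
    - move=> x /=; rewrite in_itv/= andbT => /ltW x1x; rewrite -EFinM.
      exact: tail_entropy.
  apply: ge0_subset_integral => //.
  - apply: measurable_funeM; apply/measurable_EFinP; exact: measurable_funTS.
  - by move=> x _; rewrite -EFinM lee_fin mulr_ge0 ?divr_ge0// ltW.
by rewrite lte_mul_pinfty// lee_fin divr_ge0// ltW.
Qed.

End entropy_identity.

(** * Consequences of the hypotheses on [X] for [Xtheta], and the final identity *)

Lemma absolutely_continuous_atomless d (T : measurableType d) (R : realType)
    (P : probability T R) (X : {RV P >-> R}) x :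
  absolutely_continuous X -> P [set w | X w = x] = 0%E.
Proof.
move=> /null_content_dominatesP/(_ [set x]); apply => //.
exact: lebesgue_measure_set1.
Qed.

Lemma cdfR_eq0 d (T : measurableType d) (R : realType)
    (P : probability T R) (X : {RV P >-> R}) :
  {ae P, forall w, 0 <= X w} -> P [set w | X w = 0] = 0%E -> cdfR X 0 = 0.
Proof.
move=> X0 PX0; apply: EFin_inj; rewrite cdfRE.
have mlt := measurable_RV_lt X 0.
have mX0 : measurable [set w | X w = 0].
  exact: (measurable_funPTI X (measurable_set1 0)).
have -> : [set w | X w <= 0] = [set w | X w < 0] `|` [set w | X w = 0].
  apply/seteqP; split => w /=.
    by rewrite le_eqVlt => /predU1P[->|]; [right|left].
  by move=> [/ltW//|->].
rewrite measureU0//.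
apply/negligibleP => //; apply: negligibleS X0 => w /=.
by move=> Xw; apply/negP; rewrite -ltNge.
Qed.

(** As the cdf vanishes at 0, [W] is almost surely positive and thus equal to its positive part. *)
Lemma expectation_Nln_cdf d (T : measurableType d) (R : realType)
    (P : probability T R) (W : {RV P >-> R}) (b : R) : cdfR W 0 = 0 ->
  ('E_P[(fun w => W w * (- ln (cdfR W (W w))) `^ b)%R] =
   \int[P]_w (Nln_cdf W w `^ b * Num.max 0 (W w))%:E)%E.
Proof.
move=> W0; rewrite unlock.
have mU : measurable_fun [set: T] (fun w => Nln_cdf W w `^ b).
  apply: (measurableT_comp (@measurable_powR R b)).
  exact: (measurable_Nln_cdf W).
apply: ae_eq_integral => //.
- by apply/measurable_EFinP; exact: measurable_funM.
- apply/measurable_EFinP; apply: measurable_funM => //.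
  exact: measurable_maxr.
exists [set w | W w <= 0]; split.
- exact: measurable_RV_le.
- by have := cdfRE W 0; rewrite W0 => /esym.
- move=> w /= /not_implyP[_ WU]; rewrite leNgt; apply/negP => Ww0; apply: WU.
  by rewrite max_r ?ltW// mulrC.
Qed.

Lemma PRH_surj d (T : measurableType d) d' (T' : measurableType d')
    (R : realType) (P : probability T R) (Q : probability T' R)
    (X : {RV P >-> R}) (theta : R) (W : {RV Q >-> R}) : 0 < theta ->
  PRH X theta W -> (forall v, 0 < v < 1 -> exists x, cdfR X x = v) ->
  forall v, 0 < v < 1 -> exists x, cdfR W x = v.
Proof.
move=> t0 XW XS v /andP[v0 v1].
have [|x Xx] := XS (v `^ theta^-1).
  rewrite powR_gt0//= [ltRHS](_ : 1 = 1 `^ theta^-1); last by rewrite powR1.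
  by apply: gt0_ltr_powR; rewrite ?invr_gt0 ?nnegrE ?(ltW v0).
by exists x; rewrite XW Xx -powRrM mulVf ?gt_eqF// powRr1// ltW.
Qed.

(** To the right of [r] there is no support left. At [r] itself a value below 1 would be a jump, and
    the midpoint between it and 1 would never be attained. *)
Lemma has_support_cdfR_eq1 d (T : measurableType d) (R : realType)
    (P : probability T R) (X : {RV P >-> R}) (r : R) :
  (forall v, 0 < v < 1 -> exists x, cdfR X x = v) ->
  has_support X r%:E -> forall x, r <= x -> cdfR X x = 1.
Proof.
move=> XS supX.
have X1 x : r < x -> cdfR X x = 1.
  apply: support_le_cdfR; rewrite supX.
  have -> : [set y | y <= r] = closure [set y : R | y <= r].
    by apply/closure_id; exact: closed_le.
  by apply: closure_subset => y [_]; rewrite lte_fin => /ltW.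
move=> x; rewrite le_eqVlt => /predU1P[<-|/X1//].
apply/eqP; rewrite eq_le cdfR_le1 leNgt; apply/negP => Xr1.
have Xr0 := cdfR_ge0 X r.
have [|y Xy] := XS ((cdfR X r + 1) / 2); first by apply/andP; split; lra.
have [ry|/(cdfR_nd X)] := ltP r y; last by rewrite Xy; lra.
by move: Xy; rewrite X1//; lra.
Qed.

Theorem proposition2p3 (R : realType)
  (d : measure_display) (T : measurableType d) (P : probability T R)
  (d' : measure_display) (T' : measurableType d') (Q : probability T' R)
  (X : {RV P >-> R}) (Xtheta : {RV Q >-> R})
  (l : \bar R) (alpha theta : R) :
  {ae P, forall w, 0 <= X w} ->
  absolutely_continuous X ->
  has_support X l ->
  0 < alpha ->
  ((0 < l < +oo)%E \/
   (l = +oo%E /\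
    (x * (- ln (cdfR X x)) `^ alpha) @[x --> +oo] --> 0)) ->
  0 < theta ->
  PRH X theta Xtheta ->
  CE l alpha Xtheta \is a fin_num ->
  CE l alpha Xtheta = (calE Xtheta alpha - calE Xtheta (alpha + 1))%E.
Proof.
move=> X0 acX supX a0 lP t0 XW CEfin.
have Xatom x := absolutely_continuous_atomless x acX.
have XS v := @cdfR_atomless_surj _ _ _ P X v Xatom.
have WS := PRH_surj t0 XW XS.
have W0 : cdfR Xtheta 0 = 0 by rewrite XW (cdfR_eq0 X0)// powR0// gt_eqF.
pose N x := (cdfR Xtheta x * (- ln (cdfR Xtheta x)) `^ alpha)%:E.
(* Beyond a finite [l] the cdf is 1, and the integrand is [1 * 0^alpha = 0]. *)
have IE : (\int[lebesgue_measure]_(x in oint0 l) N x =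
           \int[lebesgue_measure]_(x in `]0%R, +oo[) N x)%E.
  rewrite integral_mkcond [RHS]integral_mkcond; apply: eq_integral => x _.
  rewrite !patchE; have [x0|x0] := ltP 0 x; last first.
    rewrite !memNset//=; last by case; rewrite ltNge x0.
    by rewrite in_itv/= ltNge x0.
  rewrite [in RHS]mem_set/= ?in_itv/= ?x0//.
  case: ifPn => // /negP xl.
  have {xl lP} [r lr rx] : exists2 r, l = r%:E & r <= x.
    move: lP xl => [/andP[l0 loo]|[-> _]] xl; last first.
      by exfalso; apply: xl; rewrite inE; split=> //; exact: ltry.
    have lfin : l \is a fin_num by rewrite ge0_fin_numE// ltW.
    exists (fine l); first by rewrite fineK.
    rewrite leNgt; apply/negP => xl'; apply: xl; rewrite inE; split=> //.
    by rewrite -(fineK lfin) lte_fin.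
  rewrite lr in supX.
  rewrite /N XW (has_support_cdfR_eq1 XS supX)// powR1 ln1 oppr0.
  by rewrite powR0 ?gt_eqF// mulr0.
have G0 := Gamma_gt0 a0.
have GS0 := Gamma_gt0 (addr_gt0 a0 (@ltr01 R)).
have I0 : (0 <= \int[lebesgue_measure]_(x in `]0%R, +oo[) N x)%E.
  by apply: integral_ge0 => x _; rewrite lee_fin mulr_ge0 ?powR_ge0 ?cdfR_ge0.
(* The entropy is this integral times a positive constant, so an infinite integral would make it
   infinite. *)
have Ioo : (\int[lebesgue_measure]_(x in `]0%R, +oo[) N x < +oo)%E.
  move: CEfin; rewrite /CE IE; move: I0; case: (integral _ _ _) => [r| |]//.
    by rewrite ltry.
  by move=> _; rewrite gt0_muley// lte_fin invr_gt0.
pose EU b := (\int[Q]_w (Nln_cdf Xtheta w `^ b * Num.max 0 (Xtheta w))%:E)%E.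
have EU0 b : (0 <= EU b)%E.
  apply: integral_ge0 => w _.
  by rewrite lee_fin mulr_ge0 ?powR_ge0// le_max lexx.
have EUoo : (EU (alpha - 1)%R < +oo)%E by exact: integral_Nln_cdf_lty.
have : (alpha%:E * EU (alpha - 1)%R = EU alpha +
    \int[lebesgue_measure]_(x in `]0%R, +oo[) N x)%E.
  exact: integral_tail_Nln_cdf.
rewrite /CE IE /calE !expectation_Nln_cdf// addrK GammaD1//.
rewrite -/(EU (alpha - 1)) -/(EU alpha).
move: Ioo I0 EUoo (EU0 (alpha - 1)) (EU0 alpha).
case: (integral lebesgue_measure _ _) => [I| |]//.
(* The case [EU alpha = +oo] contradicts the identity itself, whose left side is finite. *)
case: (EU (alpha - 1)) => [A| |]//; case: (EU alpha) => [B| |]//.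
move=> _ _ _ _ _ [aA]; rewrite -!EFinM -EFinB; congr EFin.
have -> : I = alpha * A - B by lra.
by field; rewrite !gt_eqF.
Qed.
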